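(* There exists a constant $c>0$ such that the following holds. For each $d$, let $M$ be the number of edges of the final graph $G_M$ produced by the $Q_2$-free process in the hypercube $Q_d$. Then with high probability (i.e. with probability tending to $1$ as $d\to\infty$), $M > c\, d^{2/3} 2^d$.
   Context: $Q_d$ denotes the $d$-dimensional hypercube graph: vertex set $\{0,1\}^d$, two vertices adjacent iff they differ in exactly one coordinate; it has $d2^{d-1}$ edges. $Q_2$ is the 4-cycle. The $Q_2$-free process in $Q_d$ is defined as follows: start with $G_0$ the graph on $V(Q_d)$ with no edges; given $G_i$, choose an edge uniformly at random among all edges $e\in E(Q_d)\setminus E(G_i)$ such that $G_i+e$ contains no copy of $Q_2$ (as a subgraph), and let $G_{i+1}=G_i+e$. The process stops at the first $M$ for which no such edge exists, so $G_M$ is a $Q_2$-free subgraph of $Q_d$ to which no further edge of $Q_d$ can be added without creating a copy of $Q_2$, and $|E(G_M)|=M$. Equivalently, take a uniformly random ordering of $E(Q_d)$ and scan the edges in order, adding each edge if it does not create a copy of $Q_2$ with the edges already added. *)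

(* Defs.v *)
From mathcomp Require Import all_boot all_order all_algebra.

Set Implicit Arguments.
Unset Strict Implicit.
Unset Printing Implicit Defensive.

Import Order.TTheory GRing.Theory Num.Theory.

Local Open Scope ring_scope.

Definition cube (d : nat) := {ffun 'I_d -> bool}.

Definition cube_adj (d : nat) (x y : cube d) : bool :=
  #|[set i | x i != y i]| == 1%N.

(* An edge is the unordered pair of its endpoints. Since all graphs considered
   are spanning subgraphs of Q_d, a graph is identified with its edge set. *)
Definition cube_graph (d : nat) := {set {set cube d}}.

Definition cube_edges (d : nat) : cube_graph d :=
  [set e | [exists x, exists y, cube_adj x y && (e == [set x; y])]].

Definition contains_Q2 (d : nat) (G : cube_graph d) : bool :=
  [exists f : {ffun cube 2 -> cube d},
    injectiveb f && [forall e in cube_edges 2, f @: e \in G]].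

Definition available (d : nat) (G : cube_graph d) : {set {set cube d}} :=
  [set e in cube_edges d :\: G | ~~ contains_Q2 (e |: G)].

(* Transition probability from G_i = G to G_(i+1) = H. A graph with no available
   edge is made absorbing: the stopped process stays there forever. *)
Definition step_prob (R : realFieldType) (d : nat) (G H : cube_graph d) : R :=
  if available G == set0 then (H == G)%:R
  else (H \in [set e |: G | e in available G])%:R / #|available G|%:R.

(* Sample paths (G_0, ..., G_N) with N = |E(Q_d)|. At most N edges can be added,
   so the process has always stopped by time N. *)
Definition path_space (d : nat) := (#|cube_edges d|.+1).-tuple (cube_graph d).

Definition path_prob (R : realFieldType) (d : nat) (w : path_space d) : R :=
  (thead w == set0)%:R *
  \prod_(i < #|cube_edges d|) step_prob R (nth set0 w i) (nth set0 w i.+1).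

Definition process_prob (R : realFieldType) (d : nat)
    (E : pred (path_space d)) : R :=
  \sum_(w : path_space d | E w) path_prob R w.

Definition stop_time (d : nat) (w : path_space d) : nat :=
  find (fun G => available G == set0) w.

Definition final_graph (d : nat) (w : path_space d) : cube_graph d :=
  nth set0 w (stop_time w).

(* Main.v *)
(* A graph with at most [m] edges is choked when fewer than a quarter of the
   [N = d 2^(d-1)] edges of the cube can be added to it. As long as the process is
   not choked, each step adds a given edge with probability at most [4 / N], so any
   [s] given edges are all present when [m] edges have been added with probability
   at most [(4 m / N)^s]. An edge that cannot be added completes a square path,
   i.e. a square of the cube minus an edge, so a choked graph contains at least
   [N / 2] square paths; as an edge lies in [O(d)] of them, the graph then
   contains at least [(N / 4)^k] ordered [k]-tuples of pairwise disjoint ones. The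
   expected number of these is at most [(d^2 2^d (4 m / N)^3)^k], and Markov's
   inequality with [k = d] and [m] a small multiple of [d^(2/3) 2^d] shows that
   the process chokes, and a fortiori stops, with [m] edges or fewer only with
   probability at most [8^(-d)]. The argument is run as a supermartingale
   directly on the Markov chain, without passing to random orderings. *)
Require Import Defs.
From mathcomp Require Import all_boot all_order all_algebra.
From mathcomp Require Import ring lra zify.

Set Implicit Arguments.
Unset Strict Implicit.
Unset Printing Implicit Defensive.

Import Order.TTheory GRing.Theory Num.Theory.

Local Open Scope ring_scope.

Lemma sum_tuple_recl (R : nmodType) (T : finType) (n : nat) (F : seq T -> R) :
  \sum_(w : n.+1.-tuple T) F w = \sum_x \sum_(w : n.-tuple T) F (x :: w).
Proof.
rewrite pair_big /= (reindex (fun p : T * n.-tuple T => cons_tuple p.1 p.2)) //=.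
exists (fun w : n.+1.-tuple T => (thead w, behead_tuple w)) => [[x w] _|w _] /=.
  by congr pair; apply: val_inj.
by apply: val_inj; rewrite /= [in RHS](tuple_eta w).
Qed.

(** * Finite Markov chains *)

Section MarkovChain.

Variables (R : realFieldType) (T : finType) (step : T -> T -> R).
Hypothesis step_ge0 : forall x y, 0 <= step x y.
Hypothesis step_sum1 : forall x, \sum_y step x y = 1.

Fixpoint path_weight (x : T) (s : seq T) : R :=
  if s is y :: s' then step x y * path_weight y s' else 1.

Lemma path_weight_ge0 x s : 0 <= path_weight x s.
Proof. by elim: s x => //= y s IHs x; rewrite mulr_ge0. Qed.

Lemma path_weight_prod x0 x s :
  \prod_(i < size s) step (nth x0 (x :: s) i) (nth x0 (x :: s) i.+1)
  = path_weight x s.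
Proof.
elim: s x => [|y s IHs] x /=; first by rewrite big_ord0.
by rewrite big_ord_recl /= -IHs.
Qed.

Lemma path_weight_sum1 n x : \sum_(w : n.-tuple T) path_weight x w = 1.
Proof.
elim: n x => [|n IHn] x.
  by rewrite (big_pred1 [tuple]) // => w; apply/esym/eqP/tuple0.
rewrite (sum_tuple_recl _ (path_weight x)) -[RHS](step_sum1 x).
by apply: eq_bigr => y _; rewrite /= -mulr_sumr IHn mulr1.
Qed.

(** Optional stopping for a nonnegative supermartingale, by induction on the path length: in [B] the
    total mass 1 is at most [V x], and outside [B] the bound at the next state is averaged over the
    first step. [V] is controlled only on the invariant [I]. *)
Lemma hitting_prob_le (I B : pred T) (V : T -> R) :
  (forall x y, I x -> step x y != 0 -> I y) ->
  (forall x, I x -> 0 <= V x) ->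
  (forall x, I x -> B x -> 1 <= V x) ->
  (forall x, I x -> ~~ B x -> \sum_y step x y * V y <= V x) ->
  forall n x, I x ->
  \sum_(w : n.-tuple T) path_weight x w * (has B (x :: w))%:R <= V x.
Proof.
move=> Istep V0 VB Vsuper; elim=> [|n IHn] x Ix.
  rewrite (big_pred1 [tuple]) => [|w]; last by apply/esym/eqP/tuple0.
  by rewrite /= mul1r orbF; case: (boolP (B x)) => [/VB|_]; [exact | exact: V0].
rewrite (sum_tuple_recl _ (fun s => path_weight x s * (has B (x :: s))%:R)) /=.
have [Bx|nBx] := boolP (B x).
  apply: le_trans (VB x Ix Bx); rewrite -[leRHS](step_sum1 x) /=.
  apply: ler_sum => y _.
  by under eq_bigr do rewrite mulr1; rewrite -mulr_sumr path_weight_sum1 mulr1.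
apply: le_trans (Vsuper x Ix nBx); apply: ler_sum => y _ /=.
under eq_bigr do rewrite -mulrA; rewrite -mulr_sumr.
(* A successor of probability zero may leave [I], where the induction hypothesis says nothing. *)
have [->|nz] := eqVneq (step x y) 0; first by rewrite !mul0r.
by apply: ler_wpM2l => //; apply: IHn; exact: Istep nz.
Qed.

End MarkovChain.

(** * Sums over tuples of pairwise disjoint sets *)

Section DisjointTuples.

Variables (R : realFieldType) (E I : finType) (P : I -> {set E}).
Variable valid : pred I.

(** Unfolds to the sum of [f (U :|: P t_1 :|: ... :|: P t_k)] over ordered [k]-tuples of valid
    indices whose sets are disjoint from each other and from [U]. *)
Fixpoint disjoint_sum (k : nat) (f : {set E} -> R) (U : {set E}) : R :=
  if k is k'.+1 then
    \sum_(t | valid t && [disjoint P t & U]) disjoint_sum k' f (U :|: P t)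
  else f U.

Lemma disjoint_sum_le k (f g : {set E} -> R) U : (forall S, f S <= g S) ->
  disjoint_sum k f U <= disjoint_sum k g U.
Proof.
by move=> fg; elim: k U => //= k IHk U; apply: ler_sum => t _.
Qed.

Lemma disjoint_sum_ge0 k (f : {set E} -> R) U :
  (forall S, 0 <= f S) -> 0 <= disjoint_sum k f U.
Proof. by move=> f0; elim: k U => //= k IHk U; apply: sumr_ge0. Qed.

Lemma disjoint_sum_sum (J : finType) (A : pred J) k (f : J -> {set E} -> R) U :
  \sum_(j | A j) disjoint_sum k (f j) U
  = disjoint_sum k (fun S => \sum_(j | A j) f j S) U.
Proof.
by elim: k U => //= k IHk U; rewrite exchange_big; apply: eq_bigr.
Qed.

Lemma disjoint_sumMr k (f : {set E} -> R) (a : R) U :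
  disjoint_sum k f U * a = disjoint_sum k (fun S => f S * a) U.
Proof.
by elim: k U => //= k IHk U; rewrite mulr_suml; apply: eq_bigr.
Qed.

(** Disjointness makes cardinalities add, so each index contributes a factor [r ^+ s]; the sum is
    then extended to all [#|I|] indices. *)
Lemma disjoint_sum_expr_le s k (r : R) U : 0 <= r ->
  (forall t, valid t -> #|P t| = s) ->
  disjoint_sum k (fun S => r ^+ #|S|) U <= (#|I|%:R * r ^+ s) ^+ k * r ^+ #|U|.
Proof.
move=> r0 Ps; elim: k U => [|k IHk] U /=; first by rewrite expr0 mul1r.
set b := (X in X ^+ k.+1).
have b0 : 0 <= b by rewrite mulr_ge0 ?exprn_ge0.
apply: (@le_trans _ _ (\sum_(t : I) b ^+ k * (r ^+ s * r ^+ #|U|))).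
  rewrite [leLHS]big_mkcond; apply: ler_sum => t _; case: ifP => [/andP[vt dt]|_].
    apply: le_trans (IHk _) _.
    rewrite cardsU setIC disjoint_setI0 // cards0 subn0 (Ps t vt).
    by rewrite exprD [r ^+ s * _]mulrC.
  by rewrite !mulr_ge0 ?exprn_ge0.
rewrite sumr_const -mulr_natr exprS; set p := b ^+ k; rewrite /b.
by rewrite le_eqVlt; apply/orP; left; apply/eqP; ring.
Qed.

(** Greedy choice inside [G]: the union built so far never has more than [L] elements, so it blocks
    at most [D * L] valid indices and at least [y] remain at each of the [k] steps. The final union
    lies in [G], where [f] is at least 1. *)
Lemma disjoint_sum_ge (s D L k : nat) (f : {set E} -> R) (G U : {set E}) (y : R) :
  (forall S, 0 <= f S) -> (forall S : {set E}, S \subset G -> 1 <= f S) ->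
  (forall t, valid t -> #|P t| = s) ->
  (forall W : {set E},
    #|[set t | valid t && ~~ [disjoint P t & W]]| <= D * #|W|)%N ->
  0 <= y -> y + (D * L)%:R <= #|[set t | valid t && (P t \subset G)]|%:R ->
  U \subset G -> (#|U| + s * k <= L)%N ->
  y ^+ k <= disjoint_sum k f U.
Proof.
move=> f0 f1 Ps hD y0 hX; elim: k U => [|k IHk] U UG hU /=.
  by rewrite expr0 f1.
pose Q := [set t | valid t && (P t \subset G) & [disjoint P t & U]].
have yQ : y <= #|Q|%:R.
  have : (#|[set t | valid t && (P t \subset G)]| <= #|Q| + D * L)%N.
    apply: leq_trans (_ : #|Q :|: [set t | valid t && ~~ [disjoint P t & U]]| <= _)%N.
      apply/subset_leq_card/subsetP => t; rewrite !inE => /andP[-> ->] /=.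
      by case: [disjoint _ & _].
    apply: leq_trans (leq_card_setU _ _) _; rewrite leq_add2l.
    by apply: leq_trans (hD U) _; rewrite leq_mul2l; apply/orP; right; lia.
  by rewrite -(ler_nat R) natrD => h; lra.
apply: (@le_trans _ _ (\sum_(t in Q) y ^+ k)).
  by rewrite sumr_const exprS -mulr_natl ler_wpM2r ?exprn_ge0.
rewrite [leLHS]big_mkcond [leRHS]big_mkcond /=; apply: ler_sum => t _.
rewrite inE; case: (boolP (valid t)) => //= vt.
case: (boolP [disjoint P t & U]) => dt; rewrite ?andbF ?andbT //.
case: ifP => PG; last exact: disjoint_sum_ge0.
apply: IHk; first by rewrite subUset UG.
by rewrite cardsU (Ps t vt); lia.
Qed.

End DisjointTuples.

(** * Squares in the hypercube *)

Section Cube.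

Variable d : nat.
Implicit Types (x y : cube d) (i j k : 'I_d) (G U : cube_graph d).

Definition flip x i : cube d := [ffun k => x k (+) (k == i)].

Definition cube_edge x i : {set cube d} := [set x; flip x i].

Lemma flipK x i : flip (flip x i) i = x.
Proof. by apply/ffunP => k; rewrite !ffunE addbK. Qed.

Lemma flipC x i j : flip (flip x i) j = flip (flip x j) i.
Proof. by apply/ffunP => k; rewrite !ffunE addbAC. Qed.

Lemma flip_neq x i : flip x i != x.
Proof.
by apply/eqP => /ffunP/(_ i); rewrite ffunE eqxx addbT; case: (x i).
Qed.

Lemma flip_inj x : injective (flip x).
Proof.
move=> i j /ffunP/(_ i); rewrite !ffunE eqxx => /addbI/esym/eqP.
by [].
Qed.

Lemma cube_adjP x y : reflect (exists i, y = flip x i) (cube_adj x y).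
Proof.
apply: (iffP cards1P) => [[i /setP ei]|[i ->]]; exists i.
  apply/ffunP => k; rewrite ffunE; have := ei k; rewrite !inE => <-.
  by case: (x k); case: (y k).
by apply/setP => k; rewrite !inE ffunE; case: (x k); case: (k == i).
Qed.

Lemma cube_edgesP (e : {set cube d}) :
  reflect (exists x, exists i, e = cube_edge x i) (e \in cube_edges d).
Proof.
rewrite inE; apply: (iffP existsP) => [[x /existsP[y /andP[/cube_adjP[i ->]]]]|].
  by move=> /eqP->; exists x, i.
move=> [x [i ->]]; exists x; apply/existsP; exists (flip x i).
by rewrite eqxx andbT; apply/cube_adjP; exists i.
Qed.

Lemma cube_edge_in x i : cube_edge x i \in cube_edges d.
Proof. by apply/cube_edgesP; exists x, i. Qed.

Lemma cube_edge_eq x y i j : cube_edge y j = cube_edge x i ->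
  j = i /\ (y = x \/ y = flip x i).
Proof.
move=> /setP e; have := e y; have := e (flip y j).
rewrite !inE !eqxx orbT /= => /esym/orP e1 /esym/orP[]/eqP ey; subst y.
  by case: e1 => [|/eqP/flip_inj->]; [rewrite (negPf (flip_neq _ _)) | split; [|left]].
case: e1 => /eqP; last by move/eqP; rewrite (negPf (flip_neq _ _)).
by rewrite -{2}(flipK x i) => /flip_inj ->; split; [|right].
Qed.

(** An edge is described by exactly two pairs: either endpoint, with its direction. *)
Lemma card_darts_le U :
  (#|[set p : cube d * 'I_d | cube_edge p.1 p.2 \in U]| <= 2 * #|U|)%N.
Proof.
rewrite -sum1_card (partition_big (fun p => cube_edge p.1 p.2) (mem U)) /=; last first.
  by move=> p; rewrite inE.
rewrite mulnC -sum_nat_const; apply: leq_sum => e _.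
rewrite sum1_card; case: (pickP (fun p : cube d * 'I_d => cube_edge p.1 p.2 == e)).
  move=> [x i] /eqP /= <-.
  apply: (@leq_trans #|[set (x, i); (flip x i, i)]|); last by rewrite cards2 ltnS leq_b1.
  apply/subset_leq_card/subsetP => -[y j]; rewrite !inE => /andP[_ /eqP] /=.
  by move=> /cube_edge_eq[-> [] ->]; rewrite eqxx ?orbT.
by move=> h; rewrite eq_card0 // => p; apply/negP => /andP[_]; rewrite [_ == _]h.
Qed.

Lemma card_cube_edges_ge : (d * 2 ^ d <= 2 * #|cube_edges d|)%N.
Proof.
apply: leq_trans (card_darts_le _).
rewrite (_ : [set _ | _] = setT); last first.
  by apply/setP => p; rewrite in_setT inE cube_edge_in.
by rewrite cardsT card_prod card_ffun card_bool !card_ord mulnC.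
Qed.

Definition corner : finType := (cube d * 'I_d * 'I_d)%type.

Definition corner_ok (t : corner) : bool := t.1.2 != t.2.

(* For [t = (x, i, j)], the edges of the square spanned at [x] by the directions
   [i] and [j], other than the edge [{x, x + e_i}]. *)
Definition square_path (t : corner) : {set {set cube d}} :=
  let: (x, i, j) := t in
  [set cube_edge x j; cube_edge (flip x i) j; cube_edge (flip x j) i].

Lemma card_corner : #|corner| = (d ^ 2 * 2 ^ d)%N.
Proof. by rewrite !card_prod card_ffun card_bool !card_ord; lia. Qed.

Lemma card_square_path t : corner_ok t -> #|square_path t| = 3.
Proof.
case: t => [[x i] j]; rewrite /corner_ok /= => ij.
rewrite setUC cardsU1 !inE cards2.
have -> : cube_edge x j != cube_edge (flip x i) j.
  apply/eqP => /esym/cube_edge_eq[_ []/eqP]; first by rewrite (negPf (flip_neq _ _)).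
  by move/eqP/flip_inj/eqP; rewrite (negPf ij).
have h y z : cube_edge y j != cube_edge z i.
  by apply/eqP => /cube_edge_eq[/eqP]; rewrite eq_sym (negPf ij).
by rewrite ![cube_edge _ i == _]eq_sym !(negPf (h _ _)).
Qed.

Lemma card_corners_inj_le U (g : corner -> 'I_d * (cube d * 'I_d)) : injective g ->
  (#|[set t | cube_edge (g t).2.1 (g t).2.2 \in U]| <= d * (2 * #|U|))%N.
Proof.
move=> g_inj; rewrite -(card_imset _ g_inj).
set D := [set p : cube d * 'I_d | cube_edge p.1 p.2 \in U].
apply: (@leq_trans #|setX [set: 'I_d] D|).
  apply/subset_leq_card/subsetP => _ /imsetP[t + ->].
  by rewrite !inE.
by rewrite cardsX cardsT card_ord leq_mul2l card_darts_le orbT.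
Qed.

Lemma card_square_path_meet_le U :
  (#|[set t | corner_ok t && ~~ [disjoint square_path t & U]]| <= 6 * d * #|U|)%N.
Proof.
(* For each of the three edges of a square path: an endpoint and direction of that edge, preceded by
   the other direction of the square. The corner can be recovered from these data. *)
pose g1 (t : corner) := (t.1.2, (t.1.1, t.2)).
pose g2 (t : corner) := (t.1.2, (flip t.1.1 t.1.2, t.2)).
pose g3 (t : corner) := (t.2, (flip t.1.1 t.2, t.1.2)).
have i1 : injective g1 by move=> [[x i] j] [[x' i'] j'] [-> -> ->].
have i2 : injective g2.
  move=> [[x i] j] [[x' i'] j'] /= [-> e ->]; congr (_, _, _).
  by move: e => /ffunP e; apply/ffunP => k; have := e k; rewrite !ffunE => /addIb.
have i3 : injective g3.
  move=> [[x i] j] [[x' i'] j'] /= [-> e ->]; congr (_, _, _).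
  by move: e => /ffunP e; apply/ffunP => k; have := e k; rewrite !ffunE => /addIb.
pose S (g : corner -> 'I_d * (cube d * 'I_d)) :=
  [set t | cube_edge (g t).2.1 (g t).2.2 \in U].
have hS g : injective g -> (#|S g| <= d * (2 * #|U|))%N by exact: card_corners_inj_le.
apply: (@leq_trans #|S g1 :|: S g2 :|: S g3|).
  apply/subset_leq_card/subsetP => -[[x i] j]; rewrite !inE => /andP[_].
  rewrite disjoint_sym => /pred0Pn[e /=]; rewrite !inE => /andP[eU].
  by move=> /orP[/orP[]|] /eqP <-; rewrite eU ?orbT.
move: (leq_card_setU (S g1 :|: S g2) (S g3)).1 (leq_card_setU (S g1) (S g2)).1.
move: (hS _ i1) (hS _ i2) (hS _ i3); lia.
Qed.

(** If [k] differed from [j], the distinct coordinates [i] and [k], both flipped on the left, would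
    both have to be [l]. *)
Lemma square_flip x i j k l : flip (flip x i) k = flip (flip x j) l ->
  i != j -> k != i -> k = j.
Proof.
move=> /ffunP h ij ki; apply/eqP/negPn/negP => kj.
have := h i; have := h k; rewrite !ffunE !eqxx [i == k]eq_sym.
rewrite (negPf ij) (negPf ki) (negPf kj) /=.
case: (k =P l) => [<-|_]; last by case: (x k).
by rewrite [i == k]eq_sym (negPf ki); case: (x i).
Qed.

End Cube.

(** A copy of the 4-cycle in the cube is a genuine square: its opposite edges are parallel. One edge
    of the copy is the added one and the other three form the square path. The corner may sit at
    either endpoint of the added edge, so only the edges are equated. *)
Lemma contains_Q2_add d (G : cube_graph d) (x0 : cube d) (i0 : 'I_d) :
  G \subset cube_edges d -> ~~ contains_Q2 G ->
  contains_Q2 (cube_edge x0 i0 |: G) ->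
  exists t : corner d, [/\ corner_ok t, square_path t \subset G
    & cube_edge t.1.1 t.1.2 = cube_edge x0 i0].
Proof.
move=> GE Gfree /existsP[f /andP[/injectiveP f_inj /forall_inP fG]].
(* Otherwise [f] would already embed the 4-cycle in [G]. *)
have [e eE fe] : exists2 e, e \in cube_edges 2 & f @: e = cube_edge x0 i0.
  apply/exists_eq_inP; rewrite -[X in is_true X]negbK; apply/negP.
  rewrite negb_exists_in => /forall_inP ne; case/negP: Gfree.
  apply/existsP; exists f; rewrite (introT (injectiveP f) f_inj) /=.
  apply/forall_inP => e eE; have := fG e eE.
  rewrite !inE => /orP[/eqP fe|//].
  by have := ne e eE; rewrite fe eqxx.
move/cube_edgesP: eE => [y [l ey]].
have [l' ll'] : exists l' : 'I_2, l' != l.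
  by exists (rev_ord l); case: l {ey} => -[|[]].
have fG' z k : cube_edge z k != cube_edge y l -> f @: cube_edge z k \in G.
  move=> nz; have := fG _ (cube_edge_in z k); rewrite !inE -fe ey.
  by rewrite (inj_eq (imset_inj f_inj)) (negPf nz).
have f_edge z k : f @: cube_edge z k = [set f z; f (flip z k)].
  by rewrite imsetU !imset_set1.
have f_adj z k : exists j, f (flip z k) = flip (f z) j.
  have : f @: cube_edge z k \in cube_edges d.
    have := fG _ (cube_edge_in z k); rewrite in_setU1 => /orP[/eqP ->|].
      exact: cube_edge_in.
    exact: (subsetP GE).
  move=> /cube_edgesP[u [j]]; rewrite f_edge => /setP eu.
  have fz : f (flip z k) != f z by rewrite (inj_eq f_inj) flip_neq.
  have := eu (f z); have := eu (f (flip z k)).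
  rewrite !inE !eqxx orbT /= => /esym/orP[]/eqP e1 /esym/orP[]/eqP e2; exists j.
  - by rewrite e1 e2 eqxx in fz.
  - by rewrite e1 e2 flipK.
  - by rewrite e1 e2.
  - by rewrite e1 e2 eqxx in fz.
(* Directions of the images of the four edges. Injectivity of [f] separates those that meet at a
   vertex, and closing the cycle identifies opposite ones. *)
have [i fi] := f_adj y l; have [j fj] := f_adj y l'.
have [k fk] := f_adj (flip y l) l'; have [h fh] := f_adj (flip y l') l.
have ij : i != j.
  apply: contraNneq ll' => eij; apply/eqP/(@flip_inj _ y)/f_inj.
  by rewrite fi fj eij.
have ki : k != i.
  apply: contraNneq ll' => eki; apply/eqP/(@flip_inj _ (flip y l))/f_inj.
  by rewrite flipK fk fi eki flipK.
have kj : k = j.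
  by apply: (@square_flip _ (f y) i j k h) => //; rewrite -fi -fj -fk -fh flipC.
have hi : h = i.
  by apply: (@flip_inj _ (flip (f y) j)); rewrite -fj -fh flipC fk fi kj flipC fj.
exists (f y, i, j); split=> //=; last by rewrite -fe ey f_edge fi.
apply/subsetP => g; rewrite !inE => /orP[/orP[]|] /eqP ->.
- rewrite /cube_edge -fj -f_edge; apply: fG'.
  by apply/eqP => /cube_edge_eq[/eqP]; rewrite (negPf ll').
- rewrite /cube_edge -kj -fi -fk -f_edge; apply: fG'.
  by apply/eqP => /cube_edge_eq[/eqP]; rewrite (negPf ll').
- rewrite /cube_edge -hi -fj -fh -f_edge; apply: fG'.
  apply/eqP => /cube_edge_eq[_ []] /eqP; first by rewrite (negPf (flip_neq _ _)).
  by move/eqP/flip_inj/eqP; rewrite (negPf ll').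
Qed.

Lemma contains_Q2_set0 d : ~~ @contains_Q2 d set0.
Proof.
apply/existsP => -[f /andP[_ /forall_inP/(_ _ (cube_edge_in [ffun=> false] ord0))]].
by rewrite inE.
Qed.

(** * The process as a Markov chain *)

Section Process.

Variables (R : realFieldType) (d : nat).
Implicit Types (G H : cube_graph d).

Local Notation N := #|cube_edges d|.

Lemma availableP G e : reflect
  [/\ e \in cube_edges d, e \notin G & ~~ contains_Q2 (e |: G)] (e \in available G).
Proof.
have -> : (e \in available G)
    = [&& e \notin G, e \in cube_edges d & ~~ contains_Q2 (e |: G)].
  by rewrite [LHS]in_set in_setD andbA.
by apply: (iffP and3P) => -[].
Qed.

Lemma step_prob_ge0 G H : 0 <= step_prob R G H.
Proof.
by rewrite /step_prob; case: ifP => _; rewrite ?divr_ge0 ?ler0n.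
Qed.

Lemma sum_step_prob G (V : cube_graph d -> R) : available G != set0 ->
  \sum_H step_prob R G H * V H
  = (\sum_(e in available G) V (e |: G)) / #|available G|%:R.
Proof.
move=> /negPf A0; rewrite /step_prob A0.
have add_inj : {in available G &, injective (fun e => e |: G)}.
  move=> e e' /availableP[_ eG _] _ /setP/(_ e).
  by rewrite !inE eqxx /= (negPf eG) orbF => /esym/eqP.
rewrite -(big_imset V add_inj) /= mulr_suml [RHS]big_mkcond.
apply: eq_bigr => H _; case: ifP => _; last by rewrite !mul0r.
by rewrite mul1r mulrC.
Qed.

Lemma step_prob_sum1 G : \sum_H step_prob R G H = 1.
Proof.
have [A0|A0] := eqVneq (available G) set0.
  rewrite /step_prob A0 eqxx (bigD1 G) //= eqxx big1 ?addr0 // => H HG.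
  by case: eqP HG => // ->; rewrite eqxx.
under eq_bigr do rewrite -[step_prob R G _]mulr1.
by rewrite (sum_step_prob (fun=> 1)) // sumr_const divff // pnatr_eq0 cards_eq0.
Qed.

Lemma step_prob_neq0 G H : available G != set0 -> step_prob R G H != 0 ->
  exists2 e, e \in available G & H = e |: G.
Proof.
rewrite /step_prob => /negPf->; case: imsetP => [[e eA ->] _|_]; first by exists e.
by rewrite mul0r eqxx.
Qed.

(** Serves as the invariant of the chain. *)
Definition reachable G := (G \subset cube_edges d) && ~~ contains_Q2 G.

Lemma reachable_step G H : reachable G -> step_prob R G H != 0 -> reachable H.
Proof.
move=> /andP[GE Gfree]; have [A0|A0] := eqVneq (available G) set0.
  rewrite /step_prob A0 eqxx; case: (H =P G) => [-> _|_]; last by rewrite eqxx.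
  by rewrite /reachable GE Gfree.
move=> /(step_prob_neq0 A0)[e /availableP[eE _ efree] ->].
by rewrite /reachable efree subUset sub1set eE GE.
Qed.

(** Until it stops, a path of nonzero weight gains one edge per step, so at the latest it stops at
    the full cube, where no edge is left to add. *)
Lemma path_weight_stops (s : seq (cube_graph d)) G : reachable G ->
  (N <= #|G| + size s)%N -> path_weight (@step_prob R d) G s != 0 ->
  has (fun H => available H == set0) (G :: s).
Proof.
elim: s G => [|H s IHs] G GI /= hN.
  have/andP[GE _] := GI; move=> _; rewrite orbF -subset0.
  have -> : G = cube_edges d.
    by apply/eqP; rewrite eqEcard GE -(addn0 #|G|).
  by apply/subsetP => e /availableP[eE]; rewrite eE.
rewrite mulf_eq0 negb_or => /andP[sGH ws]; apply/orP.
have [_|A0] := eqVneq (available G) set0; [by left | right].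
apply: IHs ws; first exact: reachable_step sGH.
have [e /availableP[_ eG _] ->] := step_prob_neq0 A0 sGH.
by rewrite cardsU1 eG add1n addSnnS.
Qed.

Lemma path_prob_cons G (w : N.-tuple (cube_graph d)) :
  path_prob R (cons_tuple G w)
  = (G == set0)%:R * path_weight (@step_prob R d) G w.
Proof.
rewrite /path_prob theadE -(path_weight_prod _ set0) size_tuple.
by [].
Qed.

(** The event is a predicate on sequences, so that the initial graph, forced to be empty, can be
    split off the path. *)
Lemma process_probE (E : pred (seq (cube_graph d))) :
  process_prob R (fun w : path_space d => E w)
  = \sum_(w : N.-tuple (cube_graph d))
      path_weight (@step_prob R d) set0 w * (E (set0 :: w))%:R.
Proof.
pose F (s : seq (cube_graph d)) : R :=
  (head set0 s == set0)%:R * path_weight (@step_prob R d) (head set0 s) (behead s)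
  * (E s)%:R.
transitivity (\sum_(w : path_space d) F w).
  rewrite /process_prob big_mkcond; apply: eq_bigr => w _.
  have ew : w = cons_tuple (thead w) (behead_tuple w).
    by apply: val_inj; rewrite [in LHS](tuple_eta w).
  rewrite [in path_prob _ _]ew path_prob_cons /F.
  case: w {ew} => -[|G s] //= hs.
  by case: (E _); rewrite ?mulr1 ?mulr0.
rewrite sum_tuple_recl (bigD1 set0) //= [X in _ + X]big1 ?addr0 => [|G /negPf nG].
  by apply: eq_bigr => w _; rewrite /F /= eqxx mul1r.
by apply: big1 => w _; rewrite /F /= nG !mul0r.
Qed.

Lemma path_prob_ge0 (w : path_space d) : 0 <= path_prob R w.
Proof. by rewrite mulr_ge0 ?prodr_ge0 // => i _; exact: step_prob_ge0. Qed.

Lemma path_prob_sum1 : \sum_(w : path_space d) path_prob R w = 1.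
Proof.
transitivity (process_prob R
  (fun w : path_space d => predT (w : seq (cube_graph d)))); first by [].
rewrite process_probE -[RHS](path_weight_sum1 step_prob_sum1 N set0).
by apply: eq_bigr => w _; rewrite mulr1.
Qed.

Lemma process_prob_le1 (E : pred (path_space d)) : process_prob R E <= 1.
Proof.
rewrite -path_prob_sum1 /process_prob big_mkcond; apply: ler_sum => w _.
by case: ifP => // _; exact: path_prob_ge0.
Qed.

End Process.

(** * The supermartingale *)

(** The first two terms of the binomial expansion; for [s = 0] the truncated [s.-1] is multiplied by
    zero. *)
Lemma exprD_ge_linear (R : realFieldType) (a b : R) (s : nat) :
  0 <= a -> 0 <= b -> a ^+ s + b * s%:R * a ^+ s.-1 <= (a + b) ^+ s.
Proof.
move=> a0 b0; elim: s => [|s IHs]; first by rewrite mulr0 mul0r addr0.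
rewrite [leRHS]exprS; apply: le_trans (ler_wpM2l (addr_ge0 a0 b0) IHs).
rewrite -subr_ge0; case: s {IHs} => [|s] /=; first by rewrite !expr0 !expr1; lra.
have -> : (a + b) * (a ^+ s.+1 + b * s.+1%:R * a ^+ s)
    - (a ^+ s.+2 + b * s.+2%:R * a ^+ s.+1) = b ^+ 2 * s.+1%:R * a ^+ s.
  by rewrite !exprS -!natr1; ring.
by rewrite !mulr_ge0 ?exprn_ge0.
Qed.

(** A uniform [e] in [A] falls into [S] with probability at most [b * #|S :\: G|], and then lowers
    the exponent by one. The mean is thus at most the linear part of the right-hand side. *)
Lemma mean_expr_setD_le (R : realFieldType) (E : finType) (A G S : {set E})
    (a b : R) : 0 <= a -> 1 <= b * #|A|%:R -> [disjoint A & G] ->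
  (\sum_(e in A) a ^+ #|S :\: (e |: G)|) / #|A|%:R <= (a + b) ^+ #|S :\: G|.
Proof.
move=> a0 bA AG.
have A0 : 0 < #|A|%:R :> R.
  by rewrite lt0r ler0n andbT; apply: contraTneq bA => ->; rewrite mulr0 ler10.
have b0 : 0 <= b by rewrite -(pmulr_lge0 _ A0) (le_trans ler01).
apply: le_trans (exprD_ge_linear _ a0 b0); rewrite ler_pdivrMr //.
set s := #|S :\: G|.
apply: (@le_trans _ _ (\sum_(e in A) (a ^+ s + (e \in S)%:R * a ^+ s.-1))).
  apply: ler_sum => e eA; have eG := disjointFr AG eA.
  have -> : S :\: (e |: G) = (S :\: G) :\ e.
    by apply/setP => e'; rewrite !inE negb_or andbA.
  have := cardsD1 e (S :\: G); rewrite inE eG /= -/s => ->.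
  case: (e \in S); first by rewrite mul1r add1n /= lerDr exprn_ge0.
  by rewrite mul0r addr0.
have hs : (\sum_(e in A) (e \in S)%:R : R) <= s%:R.
  rewrite -natr_sum ler_nat -big_mkcondr sum1_card.
  apply/subset_leq_card/subsetP => e; rewrite !inE => /andP[eA ->].
  by rewrite (disjointFr AG eA).
rewrite big_split /= sumr_const -mulr_suml mulrDl [a ^+ s * _]mulr_natr lerD2l.
rewrite mulrAC ler_wpM2r ?exprn_ge0 //; apply: le_trans hs _.
by rewrite mulrAC ler_peMl.
Qed.

(** An edge neither in [G] nor available closes a square path contained in [G], and a corner
    determines the edge it closes. *)
Lemma card_closed_le d (G : cube_graph d) : reachable G ->
  (#|cube_edges d| <= #|G| + #|available G|
     + #|[set t | corner_ok t && (square_path t \subset G)]|)%N.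
Proof.
move=> /andP[GE Gfree]; set Q := [set _ | _].
pose Z := [set cube_edge t.1.1 t.1.2 | t in Q].
have hZ : (#|Z| <= #|Q|)%N by exact: leq_imset_card.
apply: (@leq_trans #|G :|: available G :|: Z|).
  apply/subset_leq_card/subsetP => e eE; rewrite in_setU in_setU.
  have [//|eG] := boolP (e \in G); rewrite /=.
  have [//|eA] := boolP (e \in available G); rewrite /=.
  have/cube_edgesP[x [i ex]] := eE.
  have : contains_Q2 (cube_edge x i |: G).
    by rewrite -ex; apply: contraNT eA => eA; apply/availableP.
  case/(contains_Q2_add GE Gfree) => t [tok tG te].
  by apply/imsetP; exists t; rewrite ?te // inE tok.
apply: leq_trans (leq_card_setU _ _).1 (leq_add _ hZ).
exact: (leq_card_setU _ _).1.
Qed.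

(** * Choked graphs and the potential *)

Section Potential.

Variables (R : realFieldType) (d k : nat) (m : R).
Local Notation N := #|cube_edges d|.
Hypothesis N_gt0 : (0 < N)%N.
Hypothesis m_ge0 : 0 <= m.
Hypothesis m_le : 4 * m <= N%:R.
Hypothesis k_le : (72 * d * k <= N)%N.
Implicit Types (G H : cube_graph d).

Definition choked G := (#|G|%:R <= m) && (4 * #|available G| < N)%N.

Definition rate G : R := 4 * (m - #|G|%:R) / N%:R.

(* An upper bound, given that the process has reached [G] without being choked,
   for the expected number of [k]-tuples of disjoint square paths in the graph at
   size [m]; each of the remaining [m - #|G|] steps adds a prescribed edge with
   probability at most [4 / N]. It is divided by the number [(N / 4) ^ k] of
   tuples that a choked graph is bound to contain. *)
Definition potential G : R :=
  if #|G|%:R <= m then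
    disjoint_sum (@square_path d) (@corner_ok d) k
      (fun S => rate G ^+ #|S :\: G|) set0 / (N%:R / 4) ^+ k
  else 0.

Let N_pos : 0 < N%:R :> R. Proof. by rewrite ltr0n. Qed.

Lemma rate_ge0 G : #|G|%:R <= m -> 0 <= rate G.
Proof. by move=> Gm; rewrite divr_ge0 ?mulr_ge0 ?subr_ge0. Qed.

Lemma potential_ge0 G : 0 <= potential G.
Proof.
rewrite /potential; case: ifP => // Gm.
rewrite divr_ge0 ?exprn_ge0 ?divr_ge0 //; apply: disjoint_sum_ge0 => S.
by rewrite exprn_ge0 ?rate_ge0.
Qed.

(** With at most [N / 4] edges present and fewer than [N / 4] available, more than [N / 2] corners
    have their square path in [G]. At most [3 * k] edges are ever in use, and they block at most
    [6 * d * (3 * k) <= N / 4] corners, so [N / 4] choices remain for each entry of the tuple. *)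
Lemma potential_choked G : reachable G -> choked G -> 1 <= potential G.
Proof.
move=> GI /andP[Gm GA]; rewrite /potential Gm ler_pdivlMr; last first.
  by rewrite exprn_gt0 ?divr_gt0.
rewrite mul1r; apply: (@disjoint_sum_ge R _ _ (@square_path d) (@corner_ok d) 3 (6 * d)
  (3 * k) k (fun S => rate G ^+ #|S :\: G|) G set0 (N%:R / 4)) => //.
- by move=> S; rewrite exprn_ge0 ?rate_ge0.
- by move=> S; rewrite -setD_eq0 => /eqP->; rewrite cards0.
- exact: card_square_path.
- exact: card_square_path_meet_le.
- by rewrite divr_ge0.
- have := card_closed_le GI; set X := #|[set t | _]| => hX.
  have : (N * 3 < 4 * #|G| + 4 * X)%N by lia.
  have : (4 * (6 * d * (3 * k)) <= N)%N by lia.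
  move: (6 * d * (3 * k))%N => K.
  rewrite -(ltr_nat R) -(ler_nat R) natrD !natrM.
  by move: m_le Gm; move: N%:R #|G|%:R X%:R => n g x; lra.
- exact: sub0set.
- by rewrite cards0.
Qed.

(** One step lowers the rate by exactly [4 / N], while an unchoked graph has at least [N / 4]
    available edges; [mean_expr_setD_le] with [b = 4 / N] then bounds each term of the sum. *)
Lemma potential_super G : reachable G -> ~~ choked G ->
  \sum_H step_prob R G H * potential H <= potential G.
Proof.
move=> GI; rewrite /choked; case: (boolP (#|G|%:R <= m)) => [Gm|/negPf Gm _].
- rewrite /= -leqNgt => NA.
  have A0 : available G != set0.
    by apply: contraTneq NA => ->; rewrite cards0 muln0 -ltnNge.
  rewrite sum_step_prob //.
  have card_add e : e \in available G -> #|e |: G| = #|G|.+1.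
    by move=> /availableP[_ eG _]; rewrite cardsU1 eG.
  (* A step beyond size [m] sends the potential to 0. *)
  case: (boolP (#|G|.+1%:R <= m)) => [Gm1|/negPf Gm1]; last first.
    rewrite big1 ?mul0r ?potential_ge0 // => e eA.
    by rewrite /potential (card_add e eA) Gm1.
  pose a : R := 4 * (m - #|G|.+1%:R) / N%:R.
  have a0 : 0 <= a by rewrite divr_ge0 ?mulr_ge0 ?subr_ge0.
  rewrite (eq_bigr (fun e => disjoint_sum (@square_path d) (@corner_ok d) k
      (fun S => a ^+ #|S :\: (e |: G)|) set0 / (N%:R / 4) ^+ k)); last first.
    by move=> e eA; rewrite /potential /rate (card_add e eA) Gm1.
  rewrite /potential Gm -mulr_suml mulrAC ler_wpM2r //.
    by rewrite invr_ge0 exprn_ge0 ?divr_ge0.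
  rewrite disjoint_sum_sum disjoint_sumMr; apply: disjoint_sum_le => S.
  have -> : rate G = a + 4 / N%:R.
    by rewrite /rate /a -natr1; field; rewrite lt0r_neq0.
  apply: mean_expr_setD_le => //.
    rewrite mulrAC ler_pdivlMr // mul1r -natrM ler_nat.
    exact: NA.
  by apply/pred0P => e /=; apply/negP => /andP[/availableP[_ /negPf->]].
(* Graphs never shrink, so beyond size [m] the potential stays 0. *)
- rewrite /potential Gm big1 // => H _.
  have [->|sGH] := eqVneq (step_prob R G H) 0; first by rewrite mul0r.
  suff /negPf -> : ~~ (#|H|%:R <= m) by rewrite mulr0.
  apply: contraFN Gm; apply: le_trans; rewrite ler_nat.
  move: sGH; have [A0|A0] := eqVneq (available G) set0.
    rewrite /step_prob A0 eqxx; case: (H =P G) => [->|_] //.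
    by rewrite eqxx.
  move=> /(step_prob_neq0 A0)[e _ ->].
  by apply/subset_leq_card/subsetUr.
Qed.

Lemma potential0_le :
  potential set0 <= (#|corner d|%:R * (4 * m / N%:R) ^+ 3 / (N%:R / 4)) ^+ k.
Proof.
rewrite /potential cards0 m_ge0 [leRHS]expr_div_n ler_wpM2r //.
  by rewrite invr_ge0 exprn_ge0 ?divr_ge0.
have := @disjoint_sum_expr_le R _ _ (@square_path d) (@corner_ok d) 3 k
  (4 * m / N%:R) set0.
rewrite cards0 expr0 mulr1 => h.
apply: le_trans (h _ _); last exact: card_square_path.
  apply: disjoint_sum_le => S.
  by rewrite setD0 /rate cards0 subr0.
by rewrite divr_ge0 ?mulr_ge0.
Qed.

(** A final graph has no available edge, so one with at most [m] edges is choked, and the path has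
    hit a choked graph. *)
Lemma process_prob_small_le :
  process_prob R (fun w : path_space d => #|final_graph w|%:R <= m)
  <= (#|corner d|%:R * (4 * m / N%:R) ^+ 3 / (N%:R / 4)) ^+ k.
Proof.
apply: le_trans potential0_le.
pose final (s : seq (cube_graph d)) :=
  nth set0 s (find (fun H => available H == set0) s).
rewrite (process_probE R (fun s => #|final s|%:R <= m)).
have I0 : reachable (set0 : cube_graph d).
  by rewrite /reachable sub0set contains_Q2_set0.
apply: le_trans (hitting_prob_le (B := choked) (@step_prob_ge0 R d)
  (@step_prob_sum1 R d) (@reachable_step R d) (fun G _ => potential_ge0 G)
  potential_choked potential_super N I0).
apply: ler_sum => w _; set ww := path_weight _ _ _.
have [->|w0] := eqVneq ww 0; first by rewrite !mul0r.
apply: ler_wpM2l; first by apply: path_weight_ge0 => *; exact: step_prob_ge0.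
rewrite ler_nat; case: (boolP (#|final _|%:R <= m)) => //= fm.
rewrite lt0b.
(* Stopping within the path ensures that [find] points to a true entry and not to the default. *)
have hs : has (fun H => available H == set0) (set0 :: (w : seq _)).
  by apply: (path_weight_stops I0 _ w0); rewrite size_tuple leq_addl.
apply/(@hasP _ choked (set0 :: (w : seq _))); exists (final (set0 :: (w : seq _))).
  by rewrite mem_nth // -has_find.
rewrite /choked fm /=; have := nth_find set0 hs => /= /eqP.
by rewrite /final => ->; rewrite cards0.
Qed.

Lemma process_prob_large_ge :
  1 - (#|corner d|%:R * (4 * m / N%:R) ^+ 3 / (N%:R / 4)) ^+ k
  <= process_prob R (fun w : path_space d => m < #|final_graph w|%:R).
Proof.
rewrite lerBlDr -lerBlDl; apply: le_trans process_prob_small_le.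
rewrite -[X in X - _](path_prob_sum1 R d).
rewrite (bigID (fun w : path_space d => m < #|final_graph w|%:R)) /=.
rewrite /process_prob addrAC subrr add0r.
by under [leRHS]eq_bigl do rewrite leNgt.
Qed.

End Potential.

(* Here [q] stands for [d^(2/3)]; with [m = q 2^d / 32] the quantity raised to the
   power [k] in [process_prob_large_ge] is at most [1/8]. *)
Lemma process_prob_large_ge_exp (R : realFieldType) (d : nat) (q : R) :
  (11 < d)%N -> 0 <= q -> q ^+ 3 = d%:R ^+ 2 ->
  1 - 8^-1 ^+ d <= process_prob R
    (fun w : path_space d => 32^-1 * q * 2 ^+ d < #|final_graph w|%:R).
Proof.
move=> d11 q0 q3.
have hN := card_cube_edges_ge d.
have d0 : (0 < d)%N by lia.
have N0 : (0 < #|cube_edges d|)%N.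
  move: hN; rewrite -(ltn_pmul2l (isT : (0 < 2)%N)); apply: leq_trans.
  by rewrite muln0 muln_gt0 d0 expn_gt0.
(* Yields [72 * d * d <= N] through [d 2^d <= 2 N]; the induction starts at [d = 12]. *)
have large : (144 * d <= 2 ^ d)%N.
  elim: d d11 {q3 hN d0 N0} => // n IHn; rewrite ltnS leq_eqVlt.
  by case/orP => [/eqP <- //|n11]; have := IHn n11; rewrite expnS; lia.
have hNR : d%:R * 2 ^+ d <= 2 * #|cube_edges d|%:R :> R.
  by rewrite -natrX -!natrM ler_nat.
have e1 : 0 < 2 ^+ d :> R by rewrite exprn_gt0.
have hd : 0 < d%:R :> R by rewrite ltr0n.
(* Yields [4 m <= N] for [m = q 2^d / 32]; proved by comparing cubes. *)
have q_le : q <= 4 * d%:R.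
  rewrite -(ler_pXn2r (isT : (0 < 3)%N)) ?nnegrE ?mulr_ge0 //.
  have : 1 <= d%:R :> R by rewrite ler1n.
  rewrite q3; nra.
apply: le_trans (process_prob_large_ge (k := d) N0 _ _ _); last first.
- apply: leq_trans (_ : d * (72 * d) <= _)%N; first by lia.
  by rewrite -(leq_pmul2l (isT : (0 < 2)%N)); apply: leq_trans hN; nia.
- by nra.
- by rewrite !mulr_ge0 ?invr_ge0 // ltW.
rewrite lerD2l lerN2; apply: lerXn2r; rewrite ?nnegrE ?invr_ge0 //.
  by rewrite !(divr_ge0, mulr_ge0, exprn_ge0, invr_ge0, ler0n).
rewrite card_corner natrM !natrX.
have : 0 < #|cube_edges d|%:R :> R by rewrite ltr0n.
move: {q0 q_le} hNR q3 hd e1; move: (2 ^+ d) #|cube_edges d|%:R d%:R => e N D.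
move=> hNR q3 hd e1 N1.
(* The powers of [q] combine to [q ^+ 3 = D ^+ 2]; since [D e <= 2 N], the quotient is at most
   [16 / 128 = 1 / 8], which is what the constant 32 is chosen for. *)
rewrite [leLHS](_ : _ = (D * e) ^+ 4 / (128 * N ^+ 4)); last first.
  transitivity (D ^+ 2 * q ^+ 3 * e ^+ 4 / (128 * N ^+ 4)).
    by field; rewrite lt0r_neq0.
  by rewrite q3; congr (_ / _); ring.
rewrite ler_pdivrMr ?mulr_gt0 ?exprn_gt0 //.
have : (D * e) ^+ 4 <= (2 * N) ^+ 4.
  by apply: lerXn2r => //; rewrite nnegrE mulr_ge0 ?ltW.
by rewrite exprMn; lra.
Qed.

(* Convergence of the probability to 1 *)
From mathcomp Require Import all_classical all_reals all_analysis.

Import numFieldNormedType.Exports.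

Local Open Scope classical_set_scope.
Local Open Scope ring_scope.

Theorem theorem2p1 (R : realType) :
  exists c : R, 0 < c /\
    (fun d : nat => process_prob R
       (fun w : path_space d =>
          c * (d%:R `^ (2%:R / 3%:R)) * 2%:R ^+ d < #|final_graph w|%:R))
      @ \oo --> (1 : R).
Proof.
exists 32^-1; split; first by rewrite invr_gt0.
(* The probability lies between [1 - 8^-1 ^+ d] and 1 once [d > 11]. *)
apply: (@squeeze_cvgr _ _ _ _ (fun d => 1 - 8^-1 ^+ d) (fun=> 1)).
- near=> d; rewrite process_prob_le1 andbT.
  apply: process_prob_large_ge_exp; first by near: d; exact: nbhs_infty_gt.
    exact: powR_ge0.
  rewrite -!powR_mulrn ?powR_ge0 // -powRrM; congr (_ `^ _).
  by field.
- rewrite -[X in _ --> X]subr0; apply: cvgB; first exact: cvg_cst.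
  by apply: cvg_expr; rewrite ger0_norm ?invr_ge0 // invf_lt1 // ltr1n.
- exact: cvg_cst.
Unshelve. all: by end_near.
Qed.
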